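(* Suppose that problem (P) admits a lifting $g\in H$ of its boundary data, that there exists $u^{(0)}\in H$ with $\mathcal{L}u^{(0)}=f$ in $\Omega$ and $\mathcal{B}_0u^{(0)}=0$, and that the single-object exterior-interior transmission problems (T$_i$), $i\in\{1,\dots,N\}$, are well-posed in $H$ for any $u\in H$. Then the sequence of approximations produced by the parallel form of the method of reflections satisfies $$\forall k\in\mathbb{N},\quad u^{(k+1)}-g=\Bigl(Id_H-\sum_{i=1}^NP_{V_i}\Bigr)\bigl(u^{(k)}-g\bigr),$$ where $Id_H$ is the identity operator on $H$.
   Context: **Domain and problem.** $\Omega\subset\mathbb{R}^d$ is a simply connected regular open set; $O_1,\dots,O_N\subset\Omega$ are bounded simply connected open sets with smooth boundaries and pairwise disjoint closures. $\mathcal{L}$ is a linear differential operator acting on functions defined in $\Omega$; for $1\le j\le N$, $\mathcal{B}_j$ is a linear (possibly non-local) boundary operator on $\partial O_j$; $\mathcal{B}_0$ is a linear operator encoding a homogeneous condition on $\partial\Omega$ and/or at infinity. Given $f$ on $\Omega$ and $b_j$ on $\partial O_j$, problem (P) is: find $u$ with $\mathcal{L}u=f$ in $\Omega\setminus\cup_{j=1}^N\overline{O_j}$, $\mathcal{B}_ju=b_j$ ($j=1,\dots,N$), $\mathcal{B}_0u=0$; it is assumed well-posed. A lifting of the boundary data is a function $g$ on $\Omega$ with $\mathcal{B}_jg=b_j$, $j=1,\dots,N$, and $\mathcal{B}_0g=0$. **Projections.** $H$ is a (Banach) space of functions over $\Omega$. For $u\in H$ and $i\in\{1,\dots,N\}$,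 problem (T$_i$) is: find $w\in H$ with $\mathcal{L}w=\mathcal{L}u$ in $\Omega\setminus\overline{O_i}$, $\mathcal{B}_iw=0$, $\mathcal{B}_0w=0$, $\mathcal{L}w=0$ in $O_i$, together with chosen linear transmission conditions across $\partial O_i$ (depending on $\mathcal{L}$) making the problem uniquely solvable with continuous dependence on $u$. The map $P_{M_i}:u\mapsto w$ is a continuous linear projection of $H$ with closed range $M_i$; $P_{V_i}=Id_H-P_{M_i}$ is the projection onto its range $V_i$ along $M_i$. **Parallel form of the method of reflections.** Starting from $u^{(0)}$, the reflections satisfy $\mathcal{L}u_i^{(k)}=0$ in $\Omega\setminus\overline{O_i}$, $\mathcal{B}_0u_i^{(k)}=0$, and $\mathcal{B}_iu_i^{(1)}=b_i-\mathcal{B}_iu^{(0)}$, $\mathcal{B}_iu_i^{(k+1)}=-\mathcal{B}_i\bigl(\sum_{j=1}^{i-1}u_j^{(k)}+\sum_{j=i+1}^Nu_j^{(k)}\bigr)$ for $k\ge1$. Extended to all of $\Omega$ as elements of $H$ (same notation), they are $$u_i^{(1)}=-P_{V_i}\bigl(u^{(0)}-g\bigr),\qquad u_i^{(k+1)}=-P_{V_i}\Bigl(\sum_{j=1}^{i-1}u_j^{(k)}+\sum_{j=i+1}^Nu_j^{(k)}\Bigr)\ (k\ge1).$$ The approximations are $u^{(k+1)}=u^{(k)}+\sum_{i=1}^Nu_i^{(k+1)}$, $k\in\mathbb{N}$. *)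

(* Defs.v *)
From HB Require Import structures.
From mathcomp Require Import all_boot all_order all_algebra.
From mathcomp Require Import all_classical all_reals all_analysis.

Set Implicit Arguments.
Unset Strict Implicit.
Unset Printing Implicit Defensive.

Import Order.TTheory GRing.Theory Num.Theory.
Import numFieldNormedType.Exports.

Local Open Scope classical_set_scope.
Local Open Scope ring_scope.

Section Geometry.
Context {R : realType} {d : nat}.
Implicit Types (A U K : set 'rV[R]_d) (f : 'rV[R]_d -> R).

Let unit_itv : set R := [set` `[0, 1]].

Definition boundary A : set 'rV[R]_d := closure A `\` interior A.

Definition path_connected A : Prop :=
  forall x y, A x -> A y -> exists c : R -> 'rV[R]_d,
    [/\ {within unit_itv, continuous c}, c 0 = x, c 1 = y
      & forall t, unit_itv t -> A (c t)].

(* [h (t, s)]: [t] is the loop parameter, [s] the deformation parameter. *)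
Definition null_homotopic A (c : R -> 'rV[R]_d) : Prop :=
  exists h : R * R -> 'rV[R]_d,
    [/\ {within unit_itv `*` unit_itv, continuous h},
        forall t s, unit_itv t -> unit_itv s -> A (h (t, s)),
        forall t, unit_itv t -> h (t, 0) = c t /\ h (t, 1) = c 0
      & forall s, unit_itv s -> h (0, s) = c 0 /\ h (1, s) = c 0].

Definition simply_connected A : Prop :=
  [/\ A !=set0, path_connected A
    & forall c : R -> 'rV[R]_d, {within unit_itv, continuous c} ->
        (forall t, unit_itv t -> A (c t)) -> c 0 = c 1 -> null_homotopic A c].

(* Weaker than any usual regularity of the boundary (Lipschitz, C^k): it holds
   as soon as [A] lies locally on one side of its boundary. *)
Definition regular_open A : Prop := interior (closure A) = A.

(* Iterated partial derivative along the word [s]: the multi-index notation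
   with the order of differentiation made explicit. *)
Definition pderiv (s : seq 'I_d) f : 'rV[R]_d -> R :=
  foldr (fun i h x => 'D_(delta_mx 0 i) h x) f s.

Definition smooth_on U f : Prop :=
  forall (s : seq 'I_d) x, U x ->
    {for x, continuous (pderiv s f)} /\
    (forall i : 'I_d, derivable (pderiv s f) x (delta_mx 0 i)).

(* [A] lies locally on one side of its boundary, which is locally the regular
   zero set of a C^oo function. *)
Definition smooth_boundary A : Prop :=
  forall x, boundary A x -> exists U (rho : 'rV[R]_d -> R),
    [/\ open U, U x, smooth_on U rho,
        forall y, U y -> exists i : 'I_d, pderiv [:: i] rho y != 0
      & A `&` U = [set y | U y /\ rho y < 0]].

End Geometry.

Section GeneralizedFunctions.
Context {R : realType} {d : nat}.

Definition supported_in (p : nat) (K : set 'rV[R]_d)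
    (phi : 'rV[R]_d -> 'rV[R]_p) : Prop :=
  forall x, ~ K x -> phi x = 0.

Record testfun (Omega : set 'rV[R]_d) (p : nat) := Testfun {
  testfun_val :> 'rV[R]_d -> 'rV[R]_p;
  testfun_smooth : forall j, smooth_on setT (fun x => testfun_val x 0 j);
  testfun_supp : exists K : set 'rV[R]_d,
    [/\ compact K, K `<=` Omega & supported_in K testfun_val] }.

(* Equality of generalized functions in an open subset [U] of [Omega]. *)
Definition eq_in Omega p (U : set 'rV[R]_d) (T S : testfun Omega p -> R) :
    Prop :=
  forall phi : testfun Omega p,
    (exists K : set 'rV[R]_d,
       [/\ compact K, K `<=` U & supported_in K phi]) ->
    T phi = S phi.

Definition is_distribution Omega p (T : testfun Omega p -> R) : Prop :=
  (forall (a : R) (phi psi chi : testfun Omega p),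
     (forall x, chi x = a *: phi x + psi x) ->
     T chi = a * T phi + T psi) /\
  (forall K : set 'rV[R]_d, compact K -> K `<=` Omega ->
     exists (C : R) (n : nat), forall (phi : testfun Omega p) (M : R),
       supported_in K phi ->
       (forall x (s : seq 'I_d) j, (size s <= n)%N ->
          `|pderiv s (fun y => phi y 0 j) x| <= M) ->
       `|T phi| <= C * M).

Definition borelRn : Type := g_sigma_algebraType (@open 'rV[R]_d).
HB.instance Definition _ := Measurable.on borelRn.

(* This determines the measure: Lebesgue measure is the only Borel measure on
   R^d with the right value on boxes. *)
Definition is_lebesgue_measure (mu : {measure set borelRn -> \bar R}) : Prop :=
  forall a b : 'rV[R]_d, (forall i, a 0 i <= b 0 i) ->
    mu [set x : 'rV[R]_d | forall i, a 0 i <= x 0 i <= b 0 i] =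
    (\prod_(i < d) (b 0 i - a 0 i))%:E.

Variable mu : {measure set borelRn -> \bar R}.

Definition loc_integrable (Omega : set 'rV[R]_d) (f : 'rV[R]_d -> R) : Prop :=
  forall K : set 'rV[R]_d, compact K -> K `<=` Omega ->
    mu.-integrable (K : set borelRn) (EFin \o f).

Definition weak_derivative (Omega : set 'rV[R]_d) (s : seq 'I_d)
    (f v : 'rV[R]_d -> R) : Prop :=
  loc_integrable Omega v /\
  forall phi : testfun Omega 1,
    \int[mu]_(x in Omega) (f x * pderiv s (fun y => phi y 0 0) x) =
    (-1) ^+ size s * \int[mu]_(x in Omega) (v x * phi x 0 0).

(* One term [d^outer (coef * d^inner u_inp)] in the component [out] of
   [L u]; general enough for non-smooth coefficients in divergence form. *)
Record diff_term (m p : nat) := DiffTerm {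
  out : 'I_p;
  inp : 'I_m;
  outer : seq 'I_d;
  coef : 'rV[R]_d -> R;
  inner : seq 'I_d }.

(* [L u] is a finite sum of terms [d^outer (coef * d^inner u_inp)], the inner
   derivatives being locally integrable weak derivatives and the outer ones
   being taken in the sense of distributions. *)
Definition is_differential_operator (Omega : set 'rV[R]_d) (m p : nat)
    (H : Type) (fn : H -> 'rV[R]_d -> 'rV[R]_m)
    (L : H -> testfun Omega p -> R) : Prop :=
  exists (n : nat) (t : 'I_n -> diff_term m p), forall u : H,
    exists v : 'I_n -> 'rV[R]_d -> R,
      (forall q, weak_derivative Omega (inner (t q))
                   (fun x => fn u x 0 (inp (t q))) (v q) /\
                 loc_integrable Omega (fun x => coef (t q) x * v q x)) /\
      (forall phi : testfun Omega p,
         L u phi = \sum_(q < n) (-1) ^+ size (outer (t q)) *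
           \int[mu]_(x in Omega) (coef (t q) x * v q x *
              pderiv (outer (t q)) (fun y => phi y 0 (out (t q))) x)).

End GeneralizedFunctions.

Arguments borelRn : clear implicits.

(* The data and standing assumptions.  Functions take values in R^m and the
   equations are p-dimensional, so that systems, and complex-valued problems
   read over the reals, are covered. *)
Record setting (R : realType) (d m p N : nat) := Setting {
  Omega : set 'rV[R]_d;
  obj : 'I_N -> set 'rV[R]_d;
  Omega_open : open Omega;
  Omega_regular : regular_open Omega;
  Omega_sc : simply_connected Omega;
  obj_open : forall j, open (obj j);
  obj_sub : forall j, obj j `<=` Omega;
  obj_bounded : forall j, bounded_set (obj j);
  obj_sc : forall j, simply_connected (obj j);
  obj_smooth : forall j, smooth_boundary (obj j);
  obj_disj : forall i j, i != j -> closure (obj i) `&` closure (obj j) = set0;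

  leb : {measure set (borelRn R d) -> \bar R};
  leb_lebesgue : is_lebesgue_measure leb;

  (* The Banach space of functions over [Omega]: [val_of u] is a representative
     of [u], functions being identified when equal a.e. in [Omega]. *)
  fspace : completeNormedModType R;
  val_of : fspace -> 'rV[R]_d -> 'rV[R]_m;
  val_loc_integrable :
    forall u j, loc_integrable leb Omega (fun x => val_of u x 0 j);
  val_linear : forall (a : R) (u v : fspace),
    {ae leb, forall x, Omega x ->
      val_of (a *: u + v) x = a *: val_of u x + val_of v x};
  val_inj : forall u v : fspace,
    {ae leb, forall x, Omega x -> val_of u x = val_of v x} -> u = v;

  opL : {linear fspace -> (testfun Omega p -> R^o)};
  opL_diff : is_differential_operator leb val_of opL;

  (* the space of source terms, a normed space of distributions on [Omega] *)
  source : normedModType R;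
  src_of : {linear source -> (testfun Omega p -> R^o)};
  src_distribution : forall f, is_distribution (src_of f);
  src_inj : injective src_of;

  (* [opB j] only depends on the function near the boundary of [obj j], on the
     outer side; it need not be local along this boundary. *)
  trace_space : 'I_N -> normedModType R;
  opB : forall j, {linear fspace -> trace_space j};
  opB_boundary : forall j u (U : set 'rV[R]_d),
    open U -> boundary (obj j) `<=` U ->
    {ae leb, forall x, (Omega `&` U `\` closure (obj j)) x ->
      val_of u x = 0} ->
    opB j u = 0;

  (* [opB0] only depends on the function outside compact subsets of [Omega]. *)
  trace_space0 : lmodType R;
  opB0 : {linear fspace -> trace_space0};
  opB0_boundary : forall u (K : set 'rV[R]_d), compact K -> K `<=` Omega ->
    {ae leb, forall x, (Omega `\` K) x -> val_of u x = 0} -> opB0 u = 0;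

  (* The transmission conditions across the boundary of [obj i] are
     [transm i w = 0]. *)
  jump_space : 'I_N -> lmodType R;
  transm : forall i, {linear fspace -> jump_space i};
  transm_boundary : forall i u (U : set 'rV[R]_d),
    open U -> boundary (obj i) `<=` U ->
    {ae leb, forall x, (Omega `&` U) x -> val_of u x = 0} ->
    transm i u = 0 }.

Section Problems.
Context {R : realType} {d m p N : nat} (S : setting R d m p N).
Implicit Types (u w g : fspace S) (f : source S).
Implicit Types (b : forall j, trace_space S j).

Definition perforated : set 'rV[R]_d :=
  Omega S `\` \bigcup_(j : 'I_N) closure (obj S j).

Definition exterior (i : 'I_N) : set 'rV[R]_d := Omega S `\` closure (obj S i).

(* Problem (P); only the values of [u] in [perforated] matter. *)
Definition solves_P f b u : Prop :=
  [/\ eq_in perforated (opL S u) (src_of S f),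
      forall j, opB S j u = b j
    & opB0 S u = 0].

(* Well-posedness in the sense of Hadamard: existence, uniqueness (as a function
   on the perforated domain) and continuous dependence on the data. *)
Definition P_well_posed : Prop :=
  (exists C : R, forall f b, exists2 u, solves_P f b u &
     `|u| <= C * (`|f| + \sum_(j < N) `|b j|)) /\
  (forall f b u w, solves_P f b u -> solves_P f b w ->
     {ae leb S, forall x, perforated x -> val_of u x = val_of w x}).

Definition is_lifting b g : Prop :=
  (forall j, opB S j g = b j) /\ opB0 S g = 0.

(* Problem (T_i) for the datum [u], with unknown [w]. *)
Definition solves_T (i : 'I_N) u w : Prop :=
  [/\ eq_in (exterior i) (opL S w) (opL S u),
      opB S i w = 0,
      opB0 S w = 0,
      eq_in (obj S i) (opL S w) (fun=> 0)
    & transm S i w = 0].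

Definition T_well_posed (i : 'I_N) : Prop :=
  exists2 P : fspace S -> fspace S, continuous P &
    forall u w, solves_T i u w <-> w = P u.

Definition PM (i : 'I_N) : fspace S -> fspace S :=
  fun u => xget 0 [set w | solves_T i u w].

Definition PV (i : 'I_N) : fspace S -> fspace S := idfun - PM i.

Definition sum_others (r : 'I_N -> fspace S) (i : 'I_N) : fspace S :=
  \sum_(j < N | (j < i)%N) r j + \sum_(j < N | (i < j)%N) r j.

(* [r k i] is the reflection u_i^(k), for k >= 1; [r 0] plays no role.  The
   first four fields are the exterior problems, the last two the extension to
   the whole of [Omega].  When [g] is a lifting, [opB0 S u0 = 0] and the (T_i)
   are well posed, the last two fields imply the first four. *)
Record parallel_reflections b g (u0 : fspace S)
    (r : nat -> 'I_N -> fspace S) : Prop := {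
  refl_L : forall k i, eq_in (exterior i) (opL S (r k.+1 i)) (fun=> 0);
  refl_B0 : forall k i, opB0 S (r k.+1 i) = 0;
  refl_B1 : forall i, opB S i (r 1%N i) = b i - opB S i u0;
  refl_BS : forall k i, opB S i (r k.+2 i) = - opB S i (sum_others (r k.+1) i);
  refl_ext1 : forall i, r 1%N i = - PV i (u0 - g);
  refl_extS : forall k i, r k.+2 i = - PV i (sum_others (r k.+1) i) }.

Definition parallel_approximations b g (u0 : fspace S) (u : nat -> fspace S) :
    Prop :=
  exists2 r : nat -> 'I_N -> fspace S, parallel_reflections b g u0 r &
    u 0%N = u0 /\ forall k, u k.+1 = u k + \sum_(i < N) r k.+1 i.

End Problems.

Arguments perforated {R d m p N} S.
Arguments exterior {R d m p N} S i.
Arguments PM {R d m p N} S i.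
Arguments PV {R d m p N} S i.
Arguments is_lifting {R d m p N} S b g.
Arguments parallel_approximations {R d m p N} S b g u0 u.

(* Main.v *)
Require Import Defs.
From HB Require Import structures.
From mathcomp Require Import all_boot all_order all_algebra.
From mathcomp Require Import all_classical all_reals all_analysis.

Import Order.TTheory GRing.Theory Num.Theory.
Import numFieldNormedType.Exports.
Local Open Scope ring_scope.

(** Write [e k] for [u k - g].  By induction, the [i]-th reflection at step [k+1]
    is [- PV i (e k)].  Hence [e k.+1] is [PM i (e k)] plus the reflections of
    the other objects, and [PV i], being additive and zero on the range of
    [PM i], only sees these other reflections: this is the recurrence that
    defines the [i]-th reflection at step [k+2]. *)

Section Projections.
Context {R : realType} {d m p N : nat} {S : setting R d m p N}.
Implicit Types (i : 'I_N) (u v w : fspace S).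

(** Each condition of (T_i) is linear in the pair formed by the datum and the unknown. *)
Lemma solves_TD i u v w w' :
  solves_T i u w -> solves_T i v w' -> solves_T i (u + v) (w + w').
Proof.
move=> [Lw Bw B0w Iw Jw] [Lw' Bw' B0w' Iw' Jw'].
split; rewrite ?linearD /= ?Bw ?Bw' ?B0w ?B0w' ?Jw ?Jw' ?addr0 //.
- by move=> phi phi_ext; rewrite !fctE Lw // Lw'.
- by move=> phi phi_int; rewrite !fctE Iw // Iw' // addr0.
Qed.

(** The datum enters (T_i) only through the exterior equation, which is trivial when datum and
    unknown coincide. *)
Lemma solves_T_self i u w : solves_T i u w -> solves_T i w w.
Proof. by case=> _ Bw B0w Iw Jw; split. Qed.

Lemma PM_solves i u : T_well_posed S i -> solves_T i u (PM S i u).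
Proof.
(* Existence rules out the default value 0 of [xget]. *)
by case=> P _ TP; apply: xgetPex; exists (P u); apply/TP.
Qed.

(** Reduces each identity for [PM i] below to exhibiting a solution of (T_i). *)
Lemma PM_unique i u w :
  T_well_posed S i -> solves_T i u w -> PM S i u = w.
Proof.
move=> T_wp; have [P _ TP] := T_wp.
by move=> /TP ->; apply/TP; exact: PM_solves.
Qed.

Lemma PMD i u v :
  T_well_posed S i -> PM S i (u + v) = PM S i u + PM S i v.
Proof.
by move=> T_wp; apply: PM_unique => //; apply: solves_TD; exact: PM_solves.
Qed.

Lemma PM_idem i u : T_well_posed S i -> PM S i (PM S i u) = PM S i u.
Proof.
by move=> T_wp; apply: PM_unique => //; apply: solves_T_self; exact: PM_solves.
Qed.

Lemma PVE i u : PV S i u = u - PM S i u.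
Proof. by []. Qed.

Lemma PV_PMDl i u v :
  T_well_posed S i -> PV S i (PM S i u + v) = PV S i v.
Proof.
by move=> T_wp; rewrite !PVE PMD // PM_idem // opprD addrACA subrr add0r.
Qed.

End Projections.

Lemma sum_othersE {R : realType} {d m p N : nat} {S : setting R d m p N}
    (r : 'I_N -> fspace S) (i : 'I_N) :
  \sum_(j < N) r j = r i + sum_others r i.
Proof.
rewrite (bigD1 i) //= (bigID (fun j : 'I_N => j < i)%N) /=.
by congr (_ + (_ + _)); apply: eq_bigl => j; rewrite -val_eqE /=; case: ltngtP.
Qed.

Lemma reflection_residual {R : realType} {d m p N : nat}
    {S : setting R d m p N} {b : forall j, trace_space S j} {g u0 : fspace S}
    {r : nat -> 'I_N -> fspace S} {u : nat -> fspace S} :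
  (forall i, T_well_posed S i) ->
  parallel_reflections b g u0 r ->
  u 0%N = u0 -> (forall k, u k.+1 = u k + \sum_(i < N) r k.+1 i) ->
  forall k i, r k.+1 i = - PV S i (u k - g).
Proof.
move=> T_wp r_refl u_0 u_S; elim=> [|k IHk] i.
  by rewrite u_0 (refl_ext1 r_refl).
have u_k1 : u k.+1 - g = PM S i (u k - g) + sum_others (r k.+1) i.
  (* [IHk] replaces only the [i]-th reflection; the others stay as they are, to match
     [refl_extS]. *)
  by rewrite u_S (sum_othersE _ i) IHk PVE opprB addrAC addrA subrKC.
by rewrite (refl_extS r_refl) u_k1 PV_PMDl.
Qed.

Theorem proposition3p6 (R : realType) (d m p N : nat) (S : setting R d m p N)
    (f : source S) (b : forall j, trace_space S j)
    (P_wp : P_well_posed S)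
    (g : fspace S) (g_lifting : is_lifting S b g)
    (u0 : fspace S)
    (L_u0 : eq_in (Omega S) (opL S u0) (src_of S f)) (B0_u0 : opB0 S u0 = 0)
    (T_wp : forall i, T_well_posed S i)
    (u : nat -> fspace S) (u_parallel : parallel_approximations S b g u0 u) :
  forall k, u k.+1 - g = (idfun - \sum_(i < N) PV S i) (u k - g).
Proof.
have [r r_refl [u_0 u_S]] := u_parallel => k.
(* Both sides are [u k - g] plus a sum over the objects, compared term by term. *)
rewrite u_S addrAC /= !fctE fct_sumE -sumrN; congr (_ + _).
by apply: eq_bigr => i _; exact: (reflection_residual T_wp r_refl u_0 u_S).
Qed.
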